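(* Let $\ell \ge -1$ be an integer, and let $P$ be an $(n+\ell)$-stable property for which $n(P)$ exists. Let $r\ge 3$ and let $n \ge n(P)$ be integers. Suppose that $n$ satisfies $$n \ge \begin{cases} 6\ell+26 & \text{if } r=3\\ \max\left\{3+ \ell + \frac{4(\ell+2)}{r-3},\;5+\ell+\frac{r+2\ell+7}{2r-2}\right\} & \text{if } 4 \le r \le 7\\ \ell+5+\frac{4(\ell+4)}{r-4} & \text{if } r \ge 8,\end{cases}$$ and in addition: - if $r=4$, then $n > 13-\ell$; - if $\ell=-1$ and $5\le r\le 7$, then $n>5$; - if $\ell\ge 0$ and $r=5$, then $n>\min\{17-\ell,\,10\ell+10\}$; - if $\ell\ge 0$ and $6\le r\le 7$, then $n>\min\{4r-3-\ell,\,6\ell+6\}$. Let $G$ be an $n$-vertex, $K_{r+1}$-free graph that does not have $P$. Then $$e(G) \leq e(T_r(n-1)) + (\ell+1).$$ The set $\mathcal{G}_{n,r}^{\ell}$ is nonempty, and if equality holds then $G \in \mathcal{G}_{n,r}^{\ell}$. If at least one graph in $\mathcal{G}_{n,r}^{\ell}$ does not have $P$, then the bound is tight.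
   Context: Graphs are finite and simple; $e(G)$ is the number of edges and $d_G(v)$ the degree of $v$ in $G$. For $s>0$, a property $P$ defined on all $n$-vertex graphs is $s$-stable if whenever $u,v$ are distinct nonadjacent vertices of an $n$-vertex graph $G$ such that $G+uv$ has $P$ and $d_G(u)+d_G(v)\ge s$, then $G$ itself has $P$. Here $(n+\ell)$-stable means $s=n+\ell$, where $n$ is the number of vertices. $n(P)$ denotes an integer such that each complete graph $K_n$ with $n\ge n(P)$ has property $P$, when such a value exists. $T_r(n)$ is the $n$-vertex, $r$-partite Turán graph: the complete $r$-partite graph on $n$ vertices with part sizes differing by at most 1 (if $n<r$ some parts are empty and it is $K_n$). $\mathcal{G}_{n,r}^{\ell}$ is the set of $n$-vertex, $K_{r+1}$-free graphs consisting of $T_r(n-1)$ plus one additional vertex of degree $\ell+1$. ''Tight'' means that equality is attained by some $n$-vertex, $K_{r+1}$-free graph not having $P$. *)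

(* Defs.v *)
From mathcomp Require Import all_boot all_order all_algebra zify.

Set Implicit Arguments.
Unset Strict Implicit.
Unset Printing Implicit Defensive.

Import Order.TTheory GRing.Theory Num.Theory.

(* The edge set is a finite set and the proof field is a boolean equality, so
   graphs with the same edges are Leibniz-equal (see [sgraph_inj]). *)
Record sgraph (T : finType) := SGraph {
  edges : {set {set T}};
  edgesP : [forall e in edges, #|e| == 2]
}.

Definition adj (T : finType) (G : sgraph T) (u v : T) : bool :=
  [set u; v] \in edges G.

Definition num_edges (T : finType) (G : sgraph T) : nat := #|edges G|.

Definition degree (T : finType) (G : sgraph T) (v : T) : nat :=
  #|[set u | adj G v u]|.

Lemma rel_edgesP (T : finType) (R : rel T) :
  [forall e in [set [set p.1; p.2] | p : T * T & (p.1 != p.2) && R p.1 p.2],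
     #|e| == 2].
Proof.
apply/forall_inP => e /imsetP[p]; rewrite inE => /andP[np _] ->.
by rewrite cards2 np.
Qed.

(* The loops of [R] are dropped and [R] is symmetrized (see [adj_rel]). *)
Definition graph_of_rel (T : finType) (R : rel T) : sgraph T :=
  SGraph (rel_edgesP R).

Definition complete_graph (T : finType) : sgraph T :=
  graph_of_rel (fun _ _ => true).

Definition add_edge (T : finType) (G : sgraph T) (u v : T) : sgraph T :=
  graph_of_rel (fun x y => adj G x y || ((x == u) && (y == v))).

Definition induced (T : finType) (G : sgraph T) (A : {set T}) :
    sgraph {x : T | x \in A} :=
  graph_of_rel (fun x y => adj G (val x) (val y)).

Definition sgraph_iso (T U : finType) (G : sgraph T) (H : sgraph U) : Prop :=
  exists2 f : T -> U, bijective f & forall x y, adj H (f x) (f y) = adj G x y.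

Definition clique (T : finType) (G : sgraph T) (A : {set T}) : Prop :=
  forall x y, x \in A -> y \in A -> x != y -> adj G x y.

Definition clique_free (T : finType) (k : nat) (G : sgraph T) : Prop :=
  ~ exists2 A : {set T}, #|A| = k & clique G A.

(* T_r(n): the parts are the residue classes modulo r; they are balanced by
   [turan_balanced], and some are empty when n < r. *)
Definition turan (r n : nat) : sgraph 'I_n :=
  graph_of_rel (fun i j : 'I_n => i %% r != j %% r).

Local Open Scope ring_scope.

(* No condition s > 0 is imposed: for s = n + l with l >= -1 it can only fail
   when n <= 1, and then there are no distinct u and v. *)
Definition stable (n : nat) (s : int) (P : sgraph 'I_n -> Prop) : Prop :=
  forall (G : sgraph 'I_n) (u v : 'I_n),
    u != v -> ~~ adj G u v -> P (add_edge G u v) ->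
    s <= (degree G u + degree G v)%N%:Z -> P G.

Definition turan_plus_vertex (r n : nat) (l : int) (G : sgraph 'I_n) : Prop :=
  clique_free r.+1 G /\
  exists2 v : 'I_n,
    (degree G v)%:Z = l + 1 & sgraph_iso (induced G [set~ v]) (turan r n.-1).

Local Close Scope ring_scope.

Lemma sgraph_inj (T : finType) : injective (@edges T).
Proof.
move=> [E p] [F q] /= EF; case: F / EF q => q.
by rewrite (bool_irrelevance p q).
Qed.

Lemma adjC (T : finType) (G : sgraph T) (u v : T) : adj G u v = adj G v u.
Proof. by rewrite /adj setUC. Qed.

Lemma adj_irrefl (T : finType) (G : sgraph T) (u : T) : adj G u u = false.
Proof.
apply/negP => uu; have /forall_inP/(_ _ uu) := edgesP G.
by rewrite setUid cards1.
Qed.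

Lemma adj_rel (T : finType) (R : rel T) (u v : T) :
  adj (graph_of_rel R) u v = (u != v) && (R u v || R v u).
Proof.
apply/imsetP/andP => [[[x y]] | [nuv]].
  rewrite inE /= => /andP[nxy Rxy] E.
  have nuv : u != v.
    apply: contraTneq nxy => uv; move: (cards2 x y).
    by rewrite -E uv setUid cards1; case: (x != y).
  have: u \in [set x; y] by rewrite -E set21.
  have: v \in [set x; y] by rewrite -E set22.
  rewrite !inE => /orP[] /eqP Ev /orP[] /eqP Eu; subst; split=> //;
    by rewrite ?eqxx // in nuv *; rewrite Rxy ?orbT.
case/orP=> Ruv; first by exists (u, v); rewrite // inE /= nuv.
by exists (v, u); rewrite /= ?(setUC [set u]) // inE /= eq_sym nuv.
Qed.

Lemma edges_add_edge (T : finType) (G : sgraph T) (u v : T) :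
  u != v -> edges (add_edge G u v) = [set u; v] |: edges G.
Proof.
move=> nuv; apply/setP => e; rewrite in_setU1.
apply/imsetP/orP => [[[x y]]|].
  rewrite inE /= => /andP[nxy /orP[xy|/andP[/eqP-> /eqP->]]] ->; last by left.
  by right.
case=> [/eqP->|eG]; first by exists (u, v); rewrite // inE /= nuv !eqxx orbT.
have /forall_inP/(_ _ eG)/cards2P[x [y [nxy exy]]] := edgesP G.
by exists (x, y); rewrite // inE /= nxy /adj -exy eG.
Qed.

Lemma turan_balanced (r n a b : nat) : a < r -> b < r ->
  #|[set i : 'I_n | i %% r == a]| <= #|[set i : 'I_n | i %% r == b]| + 1.
Proof.
move=> ar br; set A := [set i | _]; set B := [set i | _].
pose A' := [set i in A | r <= i].
pose f (i : 'I_n) := insubd i (i - a - r + b).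
have A'P (i : 'I_n) : i \in A' -> a + r <= i /\ (i - a) %% r = 0.
  rewrite !inE => /andP[/eqP ia ri]; rewrite {1 2}(divn_eq i r) ia addnK modnMl.
  split=> //; rewrite addnC leq_add2r; apply: leq_pmull.
  by rewrite divn_gt0 // (leq_ltn_trans _ ar).
have fE i : i \in A' -> f i = i - a - r + b :> nat.
  case/A'P=> ari _; rewrite /f val_insubd; case: ifP => // /negP[].
  by have := ltn_ord i; lia.
have fB : f @: A' \subset B.
  apply/subsetP => _ /imsetP[i iA' ->]; rewrite inE fE //.
  have [ari i0] := A'P _ iA'.
  have /dvdnP[k Ek] : r %| i - a - r by rewrite dvdn_sub ?dvdnn // /dvdn i0.
  by rewrite Ek modnMDl modn_small.
have finj : {in A' &, injective f}.
  move=> i j iA jA /(congr1 val) /=; rewrite !fE // => E; apply: val_inj => /=.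
  by have [] := A'P _ iA; have [] := A'P _ jA; lia.
have AA' : #|A :\: A'| <= 1.
  apply/card_le1_eqP => i j; rewrite !inE => /andP[+ /eqP ia] /andP[+ /eqP ja].
  rewrite ia ja eqxx /= -!ltnNge => ir jr; apply: val_inj => /=.
  by rewrite -(modn_small ir) -(modn_small jr) ia ja.
rewrite -(cardsID A' A) leq_add //; apply: leq_trans (subset_leq_card fB).
by rewrite card_in_imset // subset_leq_card // subsetIr.
Qed.

(* Main.v *)
Require Import Defs.
From mathcomp Require Import all_boot all_order all_algebra zify lra.

(* By stability, the Bondy–Chvátal closure of [G] is not complete, so Chvátal's
   argument gives a set [S] of [s >= 1] vertices of degree at most [k = s + l],
   where [s = 1] or [2 s + l < n]. For [s = 1], Turán's theorem on the other
   [n - 1] vertices gives the bound and its equality case. For [s >= 2] the bound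
   is strict. The estimate [e(G) <= s k + e(T_r(n - s))] suffices unless [s] is
   close to its upper limit, where it can fail (for [r = 3] even when [n] is
   large). There, let [D] be the largest number of neighbours that a vertex has
   outside [S], and put [m = n - s]. These neighbours span no [K_r], so
   [e(G) <= s (k + D) / 2 + e(T_{r-1}(D)) + (m - D) D], and the maximum over [D]
   is small enough apart from finitely many parameters, which are computed. *)

Set Implicit Arguments.
Unset Strict Implicit.
Unset Printing Implicit Defensive.

Import Order.TTheory GRing.Theory Num.Theory.

(** * Double counting of adjacent pairs *)

Section Count.
Variables (T : finType) (G : sgraph T).

(* Counts ordered pairs: an edge inside [A :&: B] is counted twice. *)
Definition adj_count (A B : {set T}) : nat :=
  \sum_(x in A) \sum_(y in B) adj G x y.

Definition degree_in (x : T) (B : {set T}) : nat := \sum_(y in B) adj G x y.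

Lemma degree_inE x B : degree_in x B = #|[set y in B | adj G x y]|.
Proof. by rewrite /degree_in -big_mkcondr sum1dep_card; apply: eq_card => y; rewrite !inE. Qed.

Lemma degree_in_setT x : degree_in x [set: T] = degree G x.
Proof. by rewrite degree_inE; apply: eq_card => y; rewrite !inE. Qed.

Lemma adj_countC A B : adj_count A B = adj_count B A.
Proof.
rewrite /adj_count exchange_big /=.
by apply: eq_bigr => x _; apply: eq_bigr => y _; rewrite adjC.
Qed.

Lemma degree_in_split x (C A B : {set T}) : A \subset C -> B = C :\: A ->
  degree_in x C = degree_in x A + degree_in x B.
Proof.
move=> AC ->; rewrite /degree_in (big_setID A) /=.
by rewrite (setIidPr AC).
Qed.

Lemma adj_count_split (C A B D : {set T}) : A \subset C -> B = C :\: A ->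
  adj_count D C = adj_count D A + adj_count D B.
Proof.
move=> AC BE; rewrite -big_split /=.
by apply: eq_bigr => x _; apply: degree_in_split.
Qed.

Lemma adj_count_square (C A B : {set T}) : A \subset C -> B = C :\: A ->
  adj_count C C = adj_count A A + 2 * adj_count A B + adj_count B B.
Proof.
move=> AC BE.
rewrite (adj_count_split _ AC BE) !(adj_countC C) !(adj_count_split _ AC BE).
by rewrite (adj_countC B A); lia.
Qed.

Lemma adj_count_le (A B : {set T}) k : {in A, forall x, degree_in x B <= k} ->
  adj_count A B <= #|A| * k.
Proof. by move=> h; rewrite -sum_nat_const; apply: leq_sum. Qed.

Lemma degree_incidence x : degree G x = #|[set e in edges G | x \in e]|.
Proof.
rewrite /degree; have inj : {in [set y | adj G x y] &, injective (fun y => [set x; y])}.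
  move=> y z; rewrite !inE => xy xz E.
  have: z \in [set x; y] by rewrite E set22.
  rewrite !inE => /orP[/eqP zx|/eqP->//].
  by rewrite zx adj_irrefl in xz.
rewrite -(card_in_imset inj); apply: eq_card => e; rewrite !inE.
apply/imsetP/andP => [[y]|[eG xe]].
  by rewrite inE => xy ->; rewrite set21.
have /forall_inP/(_ _ eG)/cards2P[a [b [nab eab]]] := edgesP G.
move: xe; rewrite eab !inE => /orP[]/eqP->.
  by exists b; rewrite // inE /adj -eab.
by exists a; rewrite 1?setUC // inE /adj setUC -eab.
Qed.

Lemma handshake : adj_count [set: T] [set: T] = 2 * num_edges G.
Proof.
transitivity (\sum_(x : T) \sum_(e in edges G) (x \in e : nat)).
  rewrite /adj_count; apply: eq_big => [x|x _]; first by rewrite inE.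
  have := degree_in_setT x; rewrite /degree_in => ->.
  rewrite degree_incidence -big_mkcondr sum1dep_card.
  by apply: eq_card => e; rewrite !inE.
rewrite exchange_big /= mulnC /num_edges -sum_nat_const.
apply: eq_bigr => e eG; have /forall_inP/(_ _ eG)/eqP <- := edgesP G.
by rewrite -big_mkcond sum1_card.
Qed.

End Count.

(** * The size of Turán graphs and of complete multipartite graphs *)

(* The number of edges of T_r(m) (see [num_edges_turan]), vertex by vertex: the
   vertex [i] is adjacent to all [j < i] except [i %/ r] of them. *)
Definition turan_size (r m : nat) : nat := \sum_(i < m) (i - i %/ r).

Lemma turan_sizeS r m : turan_size r m.+1 = turan_size r m + (m - m %/ r).
Proof. by rewrite /turan_size big_ord_recr. Qed.

(** A part of size a = q or a = q + 1 satisfies a^2 = (2q + 1) a - q (q + 1). Summing over the r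
    parts of T_r(m) gives the identity, whatever the remainder of m. The induction only has to
    follow the jump of q when r divides m + 1. *)
Lemma turan_size_quad r m : 0 < r -> let q := m %/ r in
  2 * turan_size r m + (2 * q + 1) * m = m * m + r * (q * q.+1).
Proof.
move=> r0 /=; elim: m => [|m IH]; first by rewrite /turan_size big_ord0 div0n; lia.
rewrite turan_sizeS divnS //; have := leq_div m r.
have := @divnK r m.+1; rewrite divnS //.
case: (r %| m.+1) => /= [/(_ isT)|_]; last by rewrite add0n; lia.
move: IH; set q := m %/ r => IH E qm.
have -> : r * ((1 + q) * (1 + q).+1) = r * (q * q.+1) + 2 * ((1 + q) * r) by lia.
by rewrite E; lia.
Qed.

Definition multipartite (T : finType) (f : T -> nat) : sgraph T :=
  graph_of_rel (fun x y => f x != f y).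

Lemma adj_multipartite (T : finType) (f : T -> nat) x y :
  adj (multipartite f) x y = (f x != f y).
Proof.
rewrite adj_rel (eq_sym (f y)) orbb andb_idl //.
by apply: contraNneq => ->.
Qed.

(* Erdős's proof of Turán's theorem: the non-neighbours of a vertex of maximum
   degree become one part, and induction colors its neighbourhood. *)
Lemma erdos_majorization (T : finType) (G : sgraph T) (r : nat) (A : {set T}) :
  (forall B : {set T}, B \subset A -> clique G B -> #|B| <= r) ->
  exists f : T -> nat,
    [/\ {in A, forall x, f x < r},
        adj_count G A A <= adj_count (multipartite f) A A
      & adj_count G A A = adj_count (multipartite f) A A ->
        {in A &, forall x y, f x = f y -> ~~ adj G x y}].
Proof.
elim: r A => [|r IH] A clA.
  have A0 : A = set0.
    apply/eqP/set0Pn => -[x xA]; have := clA [set x].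
    rewrite sub1set xA cards1 => /(_ isT) H; suff: 1 <= 0 by [].
    by apply: H => y z; rewrite !inE => /eqP-> /eqP->; rewrite eqxx.
  by exists (fun=> 0); rewrite A0 /adj_count !big_set0; split=> [x||_ x y] //; rewrite inE.
have [->|[x0 x0A]] := set_0Vmem A.
  by exists (fun=> 0); rewrite /adj_count !big_set0; split=> [x||_ x y] //; rewrite inE.
have [x xA xmax] : exists2 x, x \in A &
    forall y, y \in A -> degree_in G y A <= degree_in G x A.
  by case: (arg_maxnP (fun y => degree_in G y A) x0A) => x xA xm; exists x.
pose N := [set y in A | adj G x y].
have NA : N \subset A by apply/subsetP => y; rewrite inE => /andP[].
have xN : degree_in G x A = #|N| by rewrite degree_inE.
have [C CN|f [fr fle feq]] := IH N.
  move=> clC; rewrite -ltnS -[_.+1]add1n.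
  have xC : x \notin C.
    by apply/negP => /(subsetP CN); rewrite inE adj_irrefl andbF.
  have <- : #|x |: C| = 1 + #|C| by rewrite cardsU1 xC.
  apply: clA.
    by rewrite subUset sub1set xA (subset_trans CN).
  have adjx z : z \in C -> adj G x z.
    by move=> /(subsetP CN); rewrite inE => /andP[].
  move=> u v; rewrite !inE => /orP[/eqP->|uC] /orP[/eqP->|vC].
  - by rewrite eqxx.
  - by move=> _; apply: adjx.
  - by move=> _; rewrite adjC; apply: adjx.
  - exact: clC.
set B := A :\: N.
pose f' y := if y \in N then f y else r.
have f'B y : y \in B -> f' y = r by rewrite /f' inE => /andP[/negbTE->].
have f'N y : y \in N -> f' y = f y by rewrite /f' => ->.
have BW : adj_count G B A <= #|B| * #|N|.
  by apply: adj_count_le => y; rewrite inE -xN => /andP[_]; apply: xmax.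
have M1 : adj_count (multipartite f') N N = adj_count (multipartite f) N N.
  apply: eq_bigr => y yN; apply: eq_bigr => z zN.
  by rewrite !adj_multipartite !f'N.
have M2 : adj_count (multipartite f') N B = #|N| * #|B|.
  rewrite -sum_nat_const; apply: eq_bigr => y yN; rewrite -sum1_card.
  apply: eq_bigr => z zB; rewrite adj_multipartite f'N // f'B //.
  by rewrite neq_ltn fr.
have M3 : adj_count (multipartite f') B B = 0.
  rewrite /adj_count big1 // => y yB; rewrite big1 // => z zB.
  by rewrite adj_multipartite !f'B // eqxx.
have EM := adj_count_square (multipartite f') NA (erefl B).
have EG := adj_count_square G NA (erefl B).
rewrite (adj_count_split _ _ NA (erefl B)) (adj_countC G B N) in BW.
exists f'; split.
- move=> y yA; rewrite /f'; case: ifP => [/fr|_]; last exact: ltnSn.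
  by move/leq_trans; apply.
- by nia.
(* Doubling [BW] counts the pairs inside [B] twice, whereas [EG] counts them once. Equality
   therefore leaves no edge inside [B] and forces equality on [N]. *)
move=> E; have EN : adj_count G N N = adj_count (multipartite f) N N by nia.
have EB : adj_count G B B = 0 by nia.
have sepB y z : y \in B -> z \in B -> ~~ adj G y z.
  move=> yB zB; have /eqP := EB; rewrite sum_nat_eq0 => /forallP/(_ y).
  rewrite yB sum_nat_eq0 => /forallP/(_ z); rewrite zB /=.
  by case: (adj G y z).
move=> y z yA zA.
have [yN|yN] := boolP (y \in N); have [zN|zN] := boolP (z \in N).
- by rewrite !f'N //; apply: (feq EN).
- have zB : z \in B by rewrite inE zN.
  by rewrite f'N // f'B // => Ey; move: (fr _ yN); rewrite Ey ltnn.
- have yB : y \in B by rewrite inE yN.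
  by rewrite (f'N z) // f'B // => Ey; move: (fr _ zN); rewrite -Ey ltnn.
- by move=> _; apply: sepB; rewrite inE ?yN ?zN.
Qed.

Definition part (T : finType) (f : T -> nat) (A : {set T}) (i : nat) :
    {set T} := [set x in A | f x == i].

Section Parts.
Variables (T : finType) (f : T -> nat) (A : {set T}) (r : nat).
Hypothesis fr : {in A, forall x, f x < r}.

Lemma sum_part : \sum_(i < r) #|part f A i| = #|A|.
Proof.
transitivity (\sum_(i < r) \sum_(x in part f A i) 1).
  by apply: eq_bigr => i _; rewrite sum1_card.
rewrite -[RHS]sum1_card.
(* For r > 0, [Ordinal r0] serves as the default of [insubd]; by [fr] it is never taken as a default
   on [A]. *)
have [r0|r0] := posnP r.
  have A0 : A = set0.
    by apply/setP => x; rewrite inE; apply/negP => /fr; rewrite r0.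
  by rewrite A0 big_set0 big1 // => i _; rewrite big1 // => x; rewrite !inE.
rewrite [RHS](partition_big (fun x => insubd (Ordinal r0) (f x)) xpredT) //=.
apply: eq_bigr => i _; apply: eq_bigl => x; rewrite inE.
have [xA|] //= := boolP (x \in A).
by rewrite -val_eqE /= val_insubd fr.
Qed.

Lemma multipartite_parts :
  adj_count (multipartite f) A A + \sum_(i < r) #|part f A i| ^ 2 = #|A| ^ 2.
Proof.
have -> : \sum_(i < r) #|part f A i| ^ 2 = \sum_(x in A) #|part f A (f x)|.
  have [r0|r0] := posnP r.
    rewrite !big1 // => [x /fr|[i]]; first by rewrite r0.
    by move=> ir; exfalso; move: ir; rewrite r0.
  rewrite [RHS](partition_big (fun x => insubd (Ordinal r0) (f x)) xpredT) //=.
  apply: eq_bigr => i _; rewrite expnS expn1 -sum_nat_const.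
  have eqi x : x \in A -> (insubd (Ordinal r0) (f x) == i) = (f x == i).
    by move=> xA; rewrite -val_eqE /= val_insubd fr.
  apply: eq_big => [x|x]; rewrite inE; last by case/andP=> _ /eqP->.
  by have [xA|] //= := boolP (x \in A); rewrite eqi.
rewrite /adj_count -big_split /= expnS expn1 -sum_nat_const.
apply: eq_bigr => x xA.
have -> : #|part f A (f x)| = \sum_(y in A) (f y == f x).
  by rewrite -big_mkcondr sum1dep_card; apply: eq_card => y; rewrite !inE.
rewrite -big_split /= -sum1_card; apply: eq_bigr => y _.
by rewrite adj_multipartite eq_sym; case: (_ == _).
Qed.

End Parts.

(** For an integer a, (a - q)(a - q - 1) is nonnegative, and zero only for a = q and a = q + 1.
    Summed over the part sizes, with q = [#|A| %/ r], it is exactly the deficit from the Turán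
    number. *)
Lemma multipartite_turan (T : finType) (f : T -> nat) (A : {set T}) (r : nat) :
    0 < r -> {in A, forall x, f x < r} ->
  adj_count (multipartite f) A A <= 2 * turan_size r #|A|
   /\ (adj_count (multipartite f) A A = 2 * turan_size r #|A| <->
     forall i : 'I_r, #|A| %/ r <= #|part f A i| <= (#|A| %/ r).+1).
Proof.
move=> r0 fr; set m := #|A|; pose q := m %/ r.
(* This is (a - q)(a - q - 1), with the factors oriented so that truncated subtraction is exact. *)
pose gap (a : nat) := if a <= q then (q - a) * (q.+1 - a) else (a - q) * (a - q.+1).
have gapE a : a ^ 2 + q * q.+1 = (2 * q + 1) * a + gap a.
  by rewrite /gap expnS expn1; case: leqP => h; nia.
have E : \sum_(i < r) #|part f A i| ^ 2 + r * (q * q.+1) =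
    (2 * q + 1) * m + \sum_(i < r) gap #|part f A i|.
  rewrite -[in r * _](card_ord r) -sum_nat_const -big_split /=.
  rewrite /m -(sum_part fr) big_distrr -big_split /=.
  by apply: eq_bigr => i _; apply: gapE.
have := multipartite_parts fr; have := turan_size_quad m r0.
rewrite /= -/q -/m => E2 E3.
have E4 : adj_count (multipartite f) A A + \sum_(i < r) gap #|part f A i|
    = 2 * turan_size r m.
    rewrite -mulnn in E3; move: E E2 E3.
    move: (\sum_(i < r) gap _) (\sum_(i < r) _) => g S2.
    by move: (r * _) ((_ + 1) * m) (m * m) => X Y Z; lia.
have gap0 a : (gap a == 0) = (q <= a <= q.+1).
  by rewrite /gap; case: leqP => h; rewrite muln_eq0 !subn_eq0; lia.
split; [by rewrite -E4 leq_addr | split=> [E5 i|h]].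
  have /eqP : \sum_(i < r) gap #|part f A i| = 0 by lia.
  by rewrite sum_nat_eq0 => /forallP/(_ i); rewrite gap0.
rewrite -E4 big1 ?addn0 // => i _.
by apply/eqP; rewrite gap0.
Qed.

Lemma subset_of_card (T : finType) (A : {set T}) k :
  k <= #|A| -> exists2 B : {set T}, B \subset A & #|B| = k.
Proof.
case/card_geqP => s [us <- sA]; exists [set x in s].
  by apply/subsetP => x; rewrite inE => /sA.
by rewrite cardsE; apply/card_uniqP.
Qed.

Lemma subgraph_eq (T : finType) (G H : sgraph T) :
    (forall x y, adj G x y -> adj H x y) -> num_edges H <= num_edges G ->
  G = H.
Proof.
move=> GH le; apply/sgraph_inj/eqP; rewrite eqEcard le andbT.
apply/subsetP => e eG; have /forall_inP/(_ _ eG)/cards2P[a [b [_ eab]]] := edgesP G.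
by rewrite eab; apply: GH; rewrite /adj -eab.
Qed.

(** * Induced subgraphs and isomorphisms *)

Section Transfer.
Variables (T : finType) (G : sgraph T).

Lemma adj_induced (A : {set T}) (x y : {x : T | x \in A}) :
  adj (induced G A) x y = adj G (val x) (val y).
Proof.
rewrite adj_rel (adjC G (val y)) orbb andb_idl //.
by apply: contraTneq => ->; rewrite adj_irrefl.
Qed.

Lemma adj_count_induced (A : {set T}) :
  2 * num_edges (induced G A) = adj_count G A A.
Proof.
rewrite -handshake /adj_count [RHS]big_sub; apply: eq_big => [x|x _].
  by rewrite inE.
rewrite [RHS]big_sub; apply: eq_big => [y|y _]; first by rewrite inE.
by rewrite adj_induced.
Qed.

Lemma clique_free_leq r (A : {set T}) :
  clique_free r.+1 G -> clique G A -> #|A| <= r.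
Proof.
move=> clG clA; rewrite leqNgt; apply/negP => rA; apply: clG.
have [B BA Br] := subset_of_card rA; exists B => // x y xB yB.
by apply: clA; apply: (subsetP BA).
Qed.

Lemma clique_val (A : {set T}) (B : {set {x : T | x \in A}}) :
  clique (induced G A) B -> clique G (val @: B).
Proof.
move=> clB _ _ /imsetP[x xB ->] /imsetP[y yB ->].
by rewrite val_eqE -adj_induced; apply: clB.
Qed.

Lemma clique_free_induced k (A : {set T}) :
  clique_free k G -> clique_free k (induced G A).
Proof.
move=> clG [B Bk clB]; apply: clG; exists (val @: B); last exact: clique_val.
by rewrite card_imset //; apply: val_inj.
Qed.

Lemma clique_free_neighborhood k (x : T) (A : {set T}) :
  {in A, forall y, adj G x y} -> clique_free k.+1 G ->
  clique_free k (induced G A).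
Proof.
move=> xA clG [B Bk /clique_val clB]; apply: clG.
have adjx y : y \in val @: B -> adj G x y.
  by case/imsetP=> z _ ->; apply: xA; apply: valP.
exists (x |: val @: B).
  rewrite cardsU1 card_imset ?Bk; last exact: val_inj.
  by case: (boolP (x \in _)) => // /adjx; rewrite adj_irrefl.
move=> u v; rewrite !inE => /orP[/eqP->|uB] /orP[/eqP->|vB].
- by rewrite eqxx.
- by move=> _; apply: adjx.
- by move=> _; rewrite adjC; apply: adjx.
- exact: clB.
Qed.

Lemma num_edges_iso (U : finType) (H : sgraph U) :
  sgraph_iso G H -> num_edges G = num_edges H.
Proof.
case=> h bh adjh; suff: 2 * num_edges G = 2 * num_edges H by lia.
rewrite -!handshake /adj_count [RHS](reindex h) /=; last exact: onW_bij.
apply: eq_big => [x|x _]; first by rewrite !inE.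
rewrite [RHS](reindex h) /=; last exact: onW_bij.
by apply: eq_big => [y|y _]; rewrite ?inE ?adjh.
Qed.

End Transfer.

(** * Recognizing the Turán graph; Turán's theorem *)

(** In enumeration order, the j-th element of a color class of [f] goes to the j-th element of the
    class of [g] with the same color. *)
Lemma color_injection (T U : finType) (I : eqType) (f : T -> I) (g : U -> I) :
  (forall i, #|[pred x | f x == i]| = #|[pred y | g y == i]|) ->
  exists2 h : T -> U, injective h & forall x, g (h x) = f x.
Proof.
move=> fg; case: (pickP (@predT U)) => [y0 _|U0]; last first.
  have T0 (x : T) : False.
    have: 0 < #|[pred z | f z == f x]| by apply/card_gt0P; exists x; rewrite inE.
    by rewrite fg => /card_gt0P[y _]; have := U0 y.
  by exists (fun x => False_rect U (T0 x)) => x; case: (T0 x).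
pose F i := enum [pred x | f x == i]; pose K i := enum [pred y | g y == i].
pose h x := nth y0 (K (f x)) (index x (F (f x))).
have xF x : x \in F (f x) by rewrite mem_enum inE.
have idx x : index x (F (f x)) < size (K (f x)).
  by rewrite -cardE -fg cardE index_mem.
have hE x : g (h x) = f x.
  by have := mem_nth y0 (idx x); rewrite mem_enum inE => /eqP.
exists h => // x y E; have fxy : f x = f y by rewrite -!hE E.
have := E; rewrite /h fxy => /eqP; rewrite nth_uniq ?enum_uniq // => [/eqP|].
  by move/(congr1 (nth x (F (f y)))); rewrite !nth_index // -fxy.
by rewrite -fxy.
Qed.

Lemma color_bijection (T U : finType) (I : eqType) (f : T -> I) (g : U -> I) :
  (forall i, #|[pred x | f x == i]| = #|[pred y | g y == i]|) ->
  exists2 h : T -> U, bijective h & forall x, g (h x) = f x.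
Proof.
move=> fg; have [h hi hE] := color_injection fg; exists h => //.
have [k ki _] := color_injection (fun i => esym (fg i)).
exact/inj_card_bij/(leq_card _ ki).
Qed.

(** If [c b] is the smallest part size, every part has at most [c b + 1] vertices, so r c(b) <= m <
    r (c(b) + 1), which identifies [c b] with [m %/ r]. *)
Lemma turan_parts r m (i : 'I_r) : 0 < r ->
  m %/ r <= #|part (fun x : 'I_m => x %% r) setT i| <= (m %/ r).+1.
Proof.
move=> r0; pose c (a : 'I_r) := #|part (fun x : 'I_m => x %% r) setT a|.
have cE a : c a = #|[set x : 'I_m | x %% r == a]|.
  by apply: eq_card => x; rewrite !inE.
have bal a b : c a <= c b + 1 by rewrite !cE; apply: turan_balanced.
have : \sum_(a < r) c a = m.
  by rewrite /c sum_part ?cardsT ?card_ord // => x _; rewrite ltn_mod.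
case: (arg_minnP c (isT : xpredT i)) => b _ bmin Es.
have lo : r * c b <= m.
  rewrite -Es -[in r * _](card_ord r) -sum_nat_const.
  by apply: leq_sum => a _; apply: bmin.
have hi : m < r * (c b).+1.
  have : \sum_(a < r | a != b) c a <= r.-1 * (c b).+1.
    rewrite -[in r.-1](card_ord r) -(cardC1 b) -sum_nat_const.
    by apply: leq_sum => a _; rewrite -addn1 bal.
  move=> le; rewrite -Es (bigD1 b) //=; have -> : r * (c b).+1 = (c b).+1 + r.-1 * (c b).+1.
    by rewrite -mulSn prednK.
  by rewrite -addSn leq_add2l.
have -> : m %/ r = c b.
  apply/eqP; rewrite eqn_leq leq_divRL // mulnC lo andbT.
  by rewrite -ltnS ltn_divLR // mulnC.
by rewrite bmin //= -addn1 bal.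
Qed.

Lemma num_edges_turan r m : 0 < r -> num_edges (turan r m) = turan_size r m.
Proof.
move=> r0; suff: 2 * num_edges (turan r m) = 2 * turan_size r m by lia.
rewrite -handshake.
have fr : {in [set: 'I_m], forall x : 'I_m, x %% r < r}.
  by move=> x _; rewrite ltn_mod.
have [_] := multipartite_turan r0 fr; rewrite cardsT card_ord => [[_ ->]] // i.
exact: turan_parts.
Qed.

(** The excess of the sum over [r * q] counts the indices of value [q.+1]. Hence two balanced
    families with the same sum have the same distribution of sizes, which lets [turan_iso] match the
    parts. *)
Lemma balanced_fibers r (c : 'I_r -> nat) q v :
    (forall i, q <= c i <= q.+1) ->
  #|[pred i | c i == v]| = if v == q.+1 then \sum_i c i - r * q
    else if v == q then r - (\sum_i c i - r * q) else 0.
Proof.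
move=> cq; have E : \sum_i c i = r * q + #|[pred i | c i == q.+1]|.
  rewrite -sum1_card [X in _ + X]big_mkcond /= -[in r * _](card_ord r) -sum_nat_const.
  rewrite -big_split; apply: eq_bigr => i _; have := cq i.
  by rewrite inE; case: eqP => /=; lia.
have E1 : #|[pred i | c i == q.+1]| + #|[pred i | c i == q]| = r.
  rewrite -[RHS](card_ord r) -(cardC [pred i | c i == q.+1]); congr (_ + _).
  by apply: eq_card => i; rewrite !inE; have := cq i; lia.
case: eqP => [->|v1]; first by rewrite E addKn.
case: eqP => [->|v2]; first by lia.
apply/eq_card0 => i; rewrite inE; apply/negbTE/eqP => ci.
by have := cq i; lia.
Qed.

(** [color_bijection] is used twice: first for a permutation of the colors that matches part sizes,
    then for a bijection of the vertices that follows this permutation. *)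
Lemma turan_iso (T : finType) (G : sgraph T) (f : T -> nat) r :
    0 < r -> (forall x, f x < r) ->
    (forall x y, adj G x y = (f x != f y)) ->
    (forall i : 'I_r, #|T| %/ r <= #|part f setT i| <= (#|T| %/ r).+1) ->
  sgraph_iso G (turan r #|T|).
Proof.
move=> r0 fr adjf fbal; set m := #|T|.
have gr (x : 'I_m) : x %% r < r by rewrite ltn_mod.
pose a (i : 'I_r) := #|part f setT i|.
pose c (i : 'I_r) := #|part (fun x : 'I_m => x %% r) setT i|.
have Ea : \sum_i a i = m by rewrite /a sum_part ?cardsT.
have Ec : \sum_i c i = m by rewrite /c sum_part ?cardsT ?card_ord.
have [s [s' sK s'K] sE] : exists2 s : 'I_r -> 'I_r, bijective s & forall i, c (s i) = a i.
  apply: color_bijection => v.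
  rewrite (@balanced_fibers _ a (m %/ r)) // (@balanced_fibers _ c (m %/ r)) ?Ea ?Ec //.
  by move=> i; apply: turan_parts.
have [h bh hE] : exists2 h : T -> 'I_m, bijective h &
    forall x, Ordinal (gr (h x)) = s (Ordinal (fr x)).
  apply: (@color_bijection T 'I_m 'I_r (fun x => s (Ordinal (fr x)))
            (fun x => Ordinal (gr x))) => i.
  transitivity (c (s (s' i))).
    rewrite sE; apply: eq_card => x; rewrite !inE.
    by rewrite -(inj_eq (can_inj s'K)) sK -val_eqE.
  by rewrite s'K; apply: eq_card => x; rewrite !inE -val_eqE.
exists h => // x y; rewrite adj_multipartite adjf; congr (~~ _).
have := inj_eq (can_inj sK) (Ordinal (fr x)) (Ordinal (fr y)).
by rewrite -!hE -!val_eqE.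
Qed.

(** Equality makes the coloring [f] of [erdos_majorization] proper and its parts balanced. Then [G]
    lies in [multipartite f] and has as many edges, so the two coincide. *)
Theorem turan_theorem (T : finType) (G : sgraph T) r :
    0 < r -> clique_free r.+1 G ->
  num_edges G <= turan_size r #|T| /\
  (num_edges G = turan_size r #|T| -> sgraph_iso G (turan r #|T|)).
Proof.
move=> r0 clG; have [B _|f [fr fle feq]] := @erdos_majorization _ G r setT.
  exact: clique_free_leq.
have [mle meq] := multipartite_turan r0 fr; rewrite cardsT in mle meq.
rewrite handshake in fle feq; split; first by lia.
move=> E; have EM : adj_count (multipartite f) setT setT = 2 * turan_size r #|T| by lia.
have -> : G = multipartite f.
  apply: subgraph_eq => [x y xy|]; last by rewrite -(leq_pmul2l (isT : 0 < 2)) -handshake EM E.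
  rewrite adj_multipartite; apply: contraTneq xy.
  by apply: feq; rewrite ?inE // EM E.
apply: (turan_iso r0 (f := f)) => [x||]; first by apply: fr.
  exact: adj_multipartite.
by apply/meq.
Qed.

(** * Closure and low-degree vertices *)

Lemma adj_add_edge (T : finType) (G : sgraph T) (u v x y : T) :
  adj G x y -> adj (add_edge G u v) x y.
Proof.
move=> xy; rewrite adj_rel xy /= andbT.
by apply: contraTneq xy => ->; rewrite adj_irrefl.
Qed.

Lemma degree_mono (T : finType) (G H : sgraph T) x :
  (forall x y, adj G x y -> adj H x y) -> degree G x <= degree H x.
Proof.
by move=> GH; apply/subset_leq_card/subsetP => y; rewrite !inE; apply: GH.
Qed.

(* Chvátal's argument: [S] consists of non-neighbours of [v], where [u v] is a
   non-edge of the closure maximizing the degree sum. *)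
Lemma few_low_degrees (n L : nat) (P : sgraph 'I_n -> Prop) (G : sgraph 'I_n) :
    stable (n%:Z + (L%:Z - 1))%R P -> P (complete_graph 'I_n) -> ~ P G ->
  exists S : {set 'I_n},
    [/\ 0 < #|S|, {in S, forall x, degree G x < #|S| + L}
      & #|S| = 1 \/ 2 * #|S| + L <= n].
Proof.
(* The closure is reached by induction on the non-edges: stability keeps [P] false when an edge is
   added, and a degree bound in the larger graph holds in [G] too. *)
move=> stP cP; have [k] := ubnP (#|~: edges G|); elim: k G => // k IH G.
rewrite ltnS => Gk nPG.
have [/existsP[u /existsP[v /and3P[nuv nadj deg]]] | closed] :=
  boolP [exists u, exists v, [&& u != v, ~~ adj G u v &
     n + L <= (degree G u + degree G v).+1]].
  have [||S [S0 Sdeg Sn]] := IH (add_edge G u v).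
  - apply: leq_trans Gk; rewrite edges_add_edge //; apply/proper_card.
    rewrite properC; apply/properP; split; first exact: subsetUr.
    by exists [set u; v]; rewrite ?setU11.
  - by move=> PG; apply: nPG; apply: (stP _ _ _ nuv nadj PG); lia.
  exists S; split=> // x /Sdeg; apply: leq_ltn_trans.
  by apply: degree_mono => y z; apply: adj_add_edge.
have {}closed u v : u != v -> ~~ adj G u v -> (degree G u + degree G v).+1 < n + L.
  move=> nuv nadj; rewrite ltnNge; apply: contra closed => h.
  by apply/existsP; exists u; apply/existsP; exists v; rewrite nuv nadj.
pose Q := [pred p : 'I_n * 'I_n | (p.1 != p.2) && ~~ adj G p.1 p.2].
have [p0 Qp0|Q0] := pickP Q; last first.
  case: nPG; rewrite (_ : G = complete_graph 'I_n) //.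
  apply: sgraph_inj; apply/setP => e; apply/idP/idP => eG.
    have /forall_inP/(_ _ eG)/cards2P[a [b [nab ->]]] := edgesP G.
    by rewrite -/(adj (complete_graph _) a b) adj_rel nab.
  have /forall_inP/(_ _ eG)/cards2P[a [b [nab ->]]] := edgesP (complete_graph 'I_n).
  by have /negbT := Q0 (a, b); rewrite /= nab negbK.
have [u [v [nuv nadj uv vmax]]] : exists u v : 'I_n, [/\ u != v, ~~ adj G u v,
    degree G u <= degree G v
  & forall x y, x != y -> ~~ adj G x y ->
      degree G x + degree G y <= degree G u + degree G v].
  case: (arg_maxnP (fun p => degree G p.1 + degree G p.2) Qp0) => -[a b] /andP[/= nab adjab] mx.
  have {}mx x y : x != y -> ~~ adj G x y ->
      degree G x + degree G y <= degree G a + degree G b.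
    by move=> nxy adjxy; apply: (mx (x, y)); rewrite /= nxy.
  have [ab|/ltnW ba] := leqP (degree G a) (degree G b); first by exists a, b.
  by exists b, a; rewrite eq_sym adjC addnC.
have duv := closed u v nuv nadj.
have [kL|kL] := leqP (degree G u) L.
  by exists [set u]; rewrite cards1; split=> [//|x|]; [rewrite inE => /eqP-> |left].
pose B := [set x | (x != v) && ~~ adj G v x].
have Bv : #|B| + (degree G v).+1 = n.
  rewrite -[RHS](card_ord n) -(cardC (mem B)); congr (_ + _).
  have -> : (degree G v).+1 = #|v |: [set x | adj G v x]|.
    by rewrite cardsU1 inE adj_irrefl.
  by apply: eq_card => x; rewrite !inE negb_and !negbK.
(* The size is chosen so that [#|S| + L] is d(u) + 1, while maximality gives d(x) <= d(u) on [B].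
   From d(u) + d(v) <= n + L - 2 and d(u) <= d(v) follow both that [B] is large enough and that 2|S|
   + L <= n. *)
have [|S SB Sk] := @subset_of_card _ B ((degree G u).+1 - L); first by lia.
exists S; rewrite Sk; split; [by lia| |by right; lia].
move=> x /(subsetP SB); rewrite inE => /andP[nxv adjvx].
have := vmax x v nxv; rewrite adjC => /(_ adjvx).
lia.
Qed.

(** * Edge bounds from a set of low-degree vertices *)

Section Bounds.
Variables (T : finType) (G : sgraph T) (r k : nat) (S : {set T}).
Hypotheses (r0 : 0 < r) (clG : clique_free r.+1 G).

Lemma adj_count_turan (A : {set T}) : adj_count G A A <= 2 * turan_size r #|A|.
Proof.
rewrite -adj_count_induced leq_mul2l /=.
have [+ _] := turan_theorem r0 (clique_free_induced (A := A) clG).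
by rewrite card_sig; congr (_ <= turan_size r _); apply: eq_card.
Qed.

Hypothesis Sk : {in S, forall x, degree G x <= k}.

Lemma adj_count_low :
  2 * num_edges G + adj_count G S S
    <= 2 * (#|S| * k) + adj_count G (~: S) (~: S).
Proof.
have SC := esym (setTD S).
rewrite -handshake (adj_count_square G (subsetT S) SC).
have : adj_count G S setT <= #|S| * k.
  by apply: adj_count_le => x xS; rewrite degree_in_setT Sk.
by rewrite (adj_count_split _ _ (subsetT S) SC); lia.
Qed.

Lemma edges_low_degrees : num_edges G <= #|S| * k + turan_size r #|~: S|.
Proof. by have := adj_count_low; have := adj_count_turan (~: S); lia. Qed.

End Bounds.

(* [D] is the largest number of neighbours that any vertex of [G] has outside
   [S]; the neighbourhood realizing it contains no clique of size [r.+1]. *)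
Lemma edges_low_degrees_neighborhood (T : finType) (G : sgraph T) (r k : nat) (S : {set T}) :
    0 < r -> clique_free r.+2 G -> 0 < #|S| ->
    {in S, forall x, degree G x <= k} ->
  exists2 D, D <= #|~: S| &
    2 * num_edges G <= minn (2 * (#|S| * k)) (#|S| * (k + D))
      + 2 * turan_size r D + 2 * ((#|~: S| - D) * D).
Proof.
move=> r0 clG /card_gt0P[x0 _] Sk; set R := ~: S.
(* The maximum is over all vertices, those of [S] included, so that [D] also bounds the number of
   edges from a vertex of [S] to [R]. *)
case: (@arg_maxnP T x0 xpredT (fun x => degree_in G x R)) => // x _ xmax.
pose N := [set y in R | adj G x y]; set D := #|N|.
have NR : N \subset R by apply/subsetP => y; rewrite inE => /andP[].
have degD y : degree_in G y R <= D by rewrite /D -degree_inE; apply: xmax.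
have clN : clique_free r.+1 (induced G N).
  by apply: (clique_free_neighborhood (x := x)) => // y; rewrite inE => /andP[].
have WN : adj_count G N N <= 2 * turan_size r D.
  rewrite -adj_count_induced leq_mul2l /=.
  have [+ _] := turan_theorem r0 clN.
  by rewrite card_sig; congr (_ <= turan_size r _); apply: eq_card.
have WB : adj_count G (R :\: N) R <= (#|R| - D) * D.
  have -> : #|R| - D = #|R :\: N| by rewrite cardsDS.
  exact: adj_count_le.
have WS : adj_count G S R <= #|S| * D by apply: adj_count_le.
have SC := esym (setTD S).
have low : adj_count G S setT <= #|S| * k.
  by apply: adj_count_le => y yS; rewrite degree_in_setT Sk.
exists D; first exact: subset_leq_card.
(* The two arguments of [minn] come from bounding SS + 2 SR as 2 (SS + SR) or as (SS + SR) + SR,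
   where SS + SR <= |S| k and SR <= |S| D. *)
rewrite -handshake (adj_count_square G (subsetT S) SC) -/R.
have := adj_count_square G NR (erefl (R :\: N)).
move: WB low; rewrite (adj_count_split _ _ NR (erefl (R :\: N))).
rewrite (adj_count_split _ _ (subsetT S) SC) -/R (adj_countC G (R :\: N) N) mulnDr.
lia.
Qed.

Lemma num_edges_vertex (T : finType) (G : sgraph T) (v : T) :
  num_edges G = degree G v + num_edges (induced G [set~ v]).
Proof.
have SC := esym (setTD [set v]).
have := adj_count_square G (subsetT _) SC; rewrite handshake -(adj_count_induced G [set~ v]).
have -> : adj_count G [set v] [set v] = 0.
  by rewrite /adj_count !big_set1 adj_irrefl.
have -> : adj_count G [set v] [set~ v] = degree G v.
  rewrite /adj_count big_set1 -/(degree_in G v _) degree_inE.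
  apply: eq_card => x; rewrite !inE; apply: andb_idl.
  by apply: contraTneq => ->; rewrite adj_irrefl.
lia.
Qed.

(** * Numerical comparison of the bounds *)

(** The vertex i adds i - i %/ (r + 1) >= r i / (r + 1) edges. The estimate sums this over m <= i <
    m + j and clears denominators. *)
Lemma turan_size_diff r m j :
  r.+1 * (2 * turan_size r.+1 m) + r * (j * (2 * m + j.-1))
    <= r.+1 * (2 * turan_size r.+1 (m + j)).
Proof.
elim: j => [|j IH]; first by rewrite addn0 mul0n muln0 addn0.
have h : r * (m + j) <= r.+1 * (m + j - (m + j) %/ r.+1).
  by have := leq_divM (m + j) r.+1; have := leq_div (m + j) r.+1; nia.
rewrite addnS turan_sizeS /=.
have E : j.+1 * (2 * m + j) = j * (2 * m + j.-1) + 2 * (m + j) by case: j {IH h} => /=; lia.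
rewrite E; lia.
Qed.

(** This is the exact rounding defect of T_{r+1}(m) from the density bound r m^2 / (2 (r + 1)),
    obtained from [turan_size_quad] with m = q (r + 1) + b. *)
Lemma turan_size_sq r m :
  r.+1 * (2 * turan_size r.+1 m) + (m %% r.+1) * (r.+1 - m %% r.+1) = r * m ^ 2.
Proof.
have := turan_size_quad m (ltn0Sn r); have := divn_eq m r.+1.
have := ltn_pmod m (ltn0Sn r).
move: (m %/ r.+1) (m %% r.+1) (turan_size _ m) => q b t /= hb -> E.
have [d Ed] : exists d, d + b = r.+1 by exists (r.+1 - b); lia.
have -> : r.+1 - b = d by lia.
have Er : r = d + b - 1 by lia.
have Eb : b * d = b * r.+1 - b * b by rewrite -Ed; lia.
have h : b * b <= b * r.+1 by rewrite leq_mul2l; lia.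
rewrite Eb expnS expn1; nia.
Qed.

Lemma low_degree_bound_lin r s L n :
    1 < s -> 2 * s + L <= n ->
    2 * r.+1 * (s + L) + r * s < 2 * r * (n - 1) ->
  s * (s + L - 1) + turan_size r.+1 (n - s) < turan_size r.+1 (n - 1) + L.
Proof.
move=> s1 sn crit; have := turan_size_diff r (n - s) (s - 1).
have -> : n - s + (s - 1) = n - 1 by lia.
have -> : 2 * (n - s) + (s - 1).-1 = 2 * n - s - 2 by lia.
move: (turan_size _ _) (turan_size _ _) => t1 t2 h.
have [s' Es] : exists s', s = s'.+2 by exists (s - 2); lia.
subst s; have [d Ed] : exists d, n = d + s'.+2 by exists (n - s'.+2); lia.
subst n; rewrite -(ltn_pmul2l (isT : 0 < 2)) -(ltn_pmul2l (ltn0Sn r)).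
have E1 : s'.+2 - 1 = s'.+1 by lia.
have E2 : s'.+2 + L - 1 = s'.+1 + L by lia.
have E3 : 2 * (d + s'.+2) - s'.+2 - 2 = 2 * d + s' by lia.
have E4 : d + s'.+2 - 1 = d + s'.+1 by lia.
rewrite E1 E3 in h; rewrite E4 in crit; rewrite E2.
have : s'.+1 * (2 * r.+1 * (s'.+2 + L) + r * s'.+2) < s'.+1 * (2 * r * (d + s'.+1)).
  by rewrite ltn_pmul2l.
lia.
Qed.

(** The worst case is s = (n - L) / 2, where the conclusion reads (r + 2) L + 4 r < (r - 2) n. The
    hypothesis is (r + 1) L + 4 r <= (r - 3) n, and n > L supplies the difference. *)
Lemma crit_r_ge8 r s L n : 7 <= r -> 2 * s + L <= n ->
  (r - 3) * (L + 4) + 4 * (L + 3) <= (r - 3) * n ->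
  2 * r.+1 * (s + L) + r * s < 2 * r * (n - 1).
Proof.
move=> r7 sn; have [p Ep] : exists p, r = p + 3 by exists (r - 3); lia.
subst r; rewrite addnK => h.
have nL : L + 4 <= n by nia.
have [m Em] : exists m, n = m + 1 by exists (n - 1); lia.
subst n; rewrite addnK.
nia.
Qed.

(* The right-hand side of the hypothesis is quadratic in [D]; the conclusion is
   its maximum over real [D]. *)
Lemma neighborhood_quad r s L n D e :
    D <= n - s -> s <= n ->
    2 * e <= s * (s + L - 1 + D) + 2 * turan_size r.+1 D + 2 * ((n - s - D) * D) ->
  8 * r.+2 * e <= 4 * r.+2 * (s * (s + L - 1)) + r.+1 * (2 * n - s) ^ 2.
Proof.
move=> Dm sn; set k := s + L - 1.
have [m Em] : exists m, n = m + s by exists (n - s); lia.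
subst n; rewrite addnK in Dm *; have [g Eg] : exists g, m = g + D by exists (m - D); lia.
subst m; rewrite addnK.
have -> : 2 * (g + D + s) - s = 2 * (g + D) + s by lia.
have := turan_size_sq r D; move: (_ * (_ - _)) => x.
move: (turan_size _ _) => t h1 h2.
have {x}h1 : r.+1 * (2 * t) <= r * (D * D) by lia.
have : r.+1 * (2 * e) <= r.+1 * (s * (k + D)) + r * (D * D) + r.+1 * (2 * (g * D)) by nia.
(* This completes the square in D; the two sides agree at D = (r + 1)(2n - s) / (2 (r + 2)), where
   the real maximum lies. *)
have sq : 4 * (r.+1 * (2 * (g + D) + s)) * (r.+2 * D)
    <= (r.+1 * (2 * (g + D) + s)) ^ 2 + 4 * (r.+2 * D) ^ 2.
  move: (r.+1 * _) (r.+2 * D) => X Y.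
  by have [+ _] := nat_Cauchy X (2 * Y); rewrite expnMn; lia.
move=> h; rewrite -(leq_pmul2l (ltn0Sn r)).
by have := leq_mul (leqnn (4 * r.+2)) h; rewrite !expnS !expn0 in sq *; lia.
Qed.

(** Bounding the rounding defect of T_{r+2}(n - 1) by a constant [fl] turns the comparison into a
    polynomial inequality without remainders. *)
Lemma neighborhood_strict r s L n D e fl :
    D <= n - s -> s <= n ->
    2 * e <= s * (s + L - 1 + D) + 2 * turan_size r.+1 D + 2 * ((n - s - D) * D) ->
    (forall b, b < r.+2 -> b * (r.+2 - b) <= fl) ->
    4 * r.+2 * (s * (s + L - 1)) + r.+1 * (2 * n - s) ^ 2 + 4 * fl
      < 4 * r.+1 * (n - 1) ^ 2 + 8 * r.+2 * L ->
  e < turan_size r.+2 (n - 1) + L.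
Proof.
move=> Dm sn h hb crit; have := neighborhood_quad Dm sn h.
have := turan_size_sq r.+1 (n - 1).
have /hb := ltn_pmod (n - 1) (ltn0Sn r.+1).
move: (_ %% _ * _) crit => x crit hx ht he.
rewrite -(ltn_pmul2l (ltn0Sn r.+1)) -(ltn_pmul2l (isT : 0 < 8)).
move: crit he ht; move: (s * _) ((2 * n - s) ^ 2) ((n - 1) ^ 2) => A B C; lia.
Qed.

Lemma turan_size_sumn r m : turan_size r m = sumn [seq i - i %/ r | i <- iota 0 m].
Proof.
rewrite sumnE big_map /turan_size -(big_mkord xpredT (fun i => i - i %/ r)).
by rewrite /index_iota subn0.
Qed.

(* [turan_size] unfolded, as [\sum] does not compute. *)
Definition neighborhood_check r s L n D : bool :=
  let t a m := sumn [seq i - i %/ a | i <- iota 0 m] in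
  minn (2 * (s * (s + L - 1))) (s * (s + L - 1 + D)) + 2 * t r.-1 D
    + 2 * ((n - s - D) * D) < 2 * (t r (n - 1) + L).

(* The hypotheses of the theorem for [4 <= r <= 7], with [L = l + 1] and the
   denominators cleared. *)
Definition small_hyp r L n : bool :=
  [&& (r - 3) * (L + 2) + 4 * (L + 1) <= (r - 3) * n,
      (2 * r - 2) * (L + 4) + r + 2 * L + 5 <= (2 * r - 2) * n,
      (r == 4) ==> (14 < n + L),
      (L == 0) && (5 <= r) ==> (5 < n),
      (0 < L) && (r == 5) ==> (18 < n + L) || (10 * L < n) &
      (0 < L) && (6 <= r) ==> (4 * r - 2 < n + L) || (6 * L < n)].

(** For 4 <= r <= 7, failure of the linear criterion forces n = 2 s + L and L <= 2 s - 3, so this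
    grid contains all remaining cases with s <= 9. *)
Lemma small_cases r s L D :
    4 <= r <= 7 -> 2 <= s <= 9 -> L < 16 -> D <= s + L ->
  small_hyp r L (2 * s + L) -> neighborhood_check r s L (2 * s + L) D.
Proof.
move=> hr hs hL hD.
have : all (fun r => all (fun s => all (fun L => small_hyp r L (2 * s + L) ==>
    all (fun D => neighborhood_check r s L (2 * s + L) D) (iota 0 (s + L).+1))
    (iota 0 16)) (iota 2 8)) (iota 4 4) by vm_compute.
move=> /allP/(_ r); rewrite mem_iota => /(_ hr)/allP/(_ s).
rewrite mem_iota => /(_ hs)/allP/(_ L); rewrite mem_iota => /(_ hL)/implyP h /h.
by move=> /allP/(_ D); apply; rewrite mem_iota.
Qed.

(* For [r = 3], the only case in which completing the square in [D] gives a
   non-strict bound. *)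
Lemma extremal_case_r3 D : D <= 10 -> neighborhood_check 3 10 0 20 D.
Proof.
move=> hD.
have /allP/(_ D) : all (neighborhood_check 3 10 0 20) (iota 0 11) by vm_compute.
by apply; rewrite mem_iota.
Qed.

Lemma low_degrees_strict r s L n e D :
    3 <= r -> 2 <= s -> 2 * s + L <= n -> D <= n - s ->
    (r = 3 -> 6 * L + 20 <= n) ->
    (4 <= r <= 7 -> small_hyp r L n) ->
    (8 <= r -> (r - 4) * (L + 4) + 4 * (L + 3) <= (r - 4) * n) ->
    e <= s * (s + L - 1) + turan_size r (n - s) ->
    2 * e <= minn (2 * (s * (s + L - 1))) (s * (s + L - 1 + D))
        + 2 * turan_size r.-1 D + 2 * ((n - s - D) * D) ->
  e < turan_size r (n - 1) + L.
Proof.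
move=> r3 s2 sn Dm h3 h47 h8 eA eB.
have [q Eq] : exists q, r = q.+2 by exists (r - 2); lia.
subst r; rewrite /= in eB.
have [crit|gap] := boolP (2 * q.+2 * (s + L) + q.+1 * s < 2 * q.+1 * (n - 1)).
  by apply: leq_ltn_trans eA _; exact: low_degree_bound_lin.
have eB' : 2 * e <= s * (s + L - 1 + D) + 2 * turan_size q.+1 D + 2 * ((n - s - D) * D).
  by apply: leq_trans eB _; rewrite !leq_add2r geq_minr.
have check : neighborhood_check q.+2 s L n D -> e < turan_size q.+2 (n - 1) + L.
  rewrite /neighborhood_check -!turan_size_sumn /= => c.
  by rewrite -(ltn_pmul2l (isT : 0 < 2)); apply: leq_ltn_trans c.
have quad fl := @neighborhood_strict q s L n D e fl Dm ltac:(lia) eB'.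
have [q1|] := eqVneq q 1.
  subst q; have {}h3 := h3 erefl.
  have [n20|n20] := boolP [&& L == 0, s == 10 & n == 20].
    case/and3P: n20 => /eqP E1 /eqP E2 /eqP E3; subst.
    by apply/check/extremal_case_r3.
  (* The maximum of b (3 - b) for b < 3 is 2. *)
  apply: (quad 2) => [b|].
    by case: b => [|[|[|b]]].
  clear -gap h3 n20 sn s2.
  have [j Ej] : exists j, n = 2 * s + L + j by exists (n - 2 * s - L); lia.
  subst n; have [u Eu] : exists u, s = u + 2 by exists (s - 2); lia.
  subst s; rewrite -leqNgt in gap.
  have -> : u + 2 + L - 1 = u + L + 1 by lia.
  have -> : 2 * (2 * (u + 2) + L + j) - (u + 2) = 3 * u + 2 * L + 2 * j + 6 by lia.
  have -> : 2 * (u + 2) + L + j - 1 = 2 * u + L + j + 3 by lia.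
  rewrite !expnS !expn0 !muln1. nia.
move=> q1; have [r8|r7] := leqP 8 q.+2.
  case/negP: gap; apply: crit_r_ge8 => //.
  by have := h8 r8; have -> : q.+2 - 4 = q.+1 - 3 by lia.
have hyp : small_hyp q.+2 L n by apply: h47; lia.
have /andP[hyp1 _] := hyp.
have Q : q = 2 \/ q = 3 \/ q = 4 \/ q = 5 by lia.
(* With n = 2s + L + j, [gap] gives (r - 3) s + 2 (r - 1)(j - 1) <= 2 L, and [hyp1] gives 4 (L + 1)
   <= (r - 3)(2s + j - 2). Together they force j = 0, and then r - 3 <= 4 yields L <= 2s - 3. *)
have [n2 Lle] : n = 2 * s + L /\ L <= 2 * s - 3.
  by case: Q => [|[|[|]]] Q; subst q; lia.
have [s9|s10] := leqP s 9.
  subst n; apply/check/small_cases => //; lia.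
clear check eA eB eB' hyp h3 h47 h8 Dm sn.
subst n; have E0 : 2 * (2 * s + L) - s = 3 * s + 2 * L by lia.
rewrite E0 in quad; clear E0.
have [u Eu] : exists u, s = u + 10 by exists (s - 10); lia.
subst s.
have E1 : u + 10 + L - 1 = u + L + 9 by lia.
have E2 : 2 * (u + 10) + L - 1 = 2 * u + L + 19 by lia.
have E3 : 3 * (u + 10) + 2 * L = 3 * u + 2 * L + 30 by lia.
rewrite E1 E2 E3 in quad; rewrite E2 -leqNgt in gap; rewrite E2.
(* The constants 4, 6, 9, 12 are the maxima of b (r - b) for r = 4, 5, 6, 7. *)
case: Q => [Q|[Q|[Q|Q]]].
- subst q; apply: (quad 4) => [b|]; first by move: b; do 5?case=> //.
  rewrite !expnS !expn0 !muln1; nia.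
- subst q; apply: (quad 6) => [b|]; first by move: b; do 6?case=> //.
  rewrite !expnS !expn0 !muln1; nia.
- subst q; apply: (quad 9) => [b|]; first by move: b; do 7?case=> //.
  rewrite !expnS !expn0 !muln1; nia.
- subst q; apply: (quad 12) => [b|]; first by move: b; do 8?case=> //.
  rewrite !expnS !expn0 !muln1; nia.
Qed.

(** * Existence of the extremal graphs *)

Lemma colored_clique_free (T : finType) (G : sgraph T) r (f : T -> 'I_r) :
  (forall x y, adj G x y -> f x != f y) -> clique_free r.+1 G.
Proof.
move=> fadj [A Ar clA]; have fi : {in A &, injective f}.
  move=> x y xA yA fxy; apply/eqP; apply: contraT => nxy.
  by have := fadj _ _ (clA x y xA yA nxy); rewrite fxy eqxx.
by have := max_card (f @: A); rewrite card_in_imset // Ar card_ord ltnn.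
Qed.

(** A new vertex joined only to vertices outside part 0 can be put into part 0, so the graph stays
    r-partite. Part 0 has at most [N %/ r + 1] vertices, which leaves at least L outside. *)
Lemma turan_plus_vertex_exists r N L :
  0 < r -> L + N %/ r < N ->
  exists G : sgraph 'I_N.+1, turan_plus_vertex r (L%:Z - 1)%R G.
Proof.
move=> r0 LN; pose F := [set i : 'I_N | i %% r != 0].
have [A AF AL] : exists2 A : {set 'I_N}, A \subset F & #|A| = L.
  apply: subset_of_card; pose F0 := part (fun x : 'I_N => x %% r) [set: 'I_N] 0.
  have /andP[_] : N %/ r <= #|F0| <= (N %/ r).+1.
    exact: turan_parts (Ordinal r0) r0.
  have := cardC F0; rewrite card_ord (_ : #|[predC _]| = #|F|).
    by move: #|F0| #|F| => a b; lia.
  by apply: eq_card => i; rewrite !inE.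
pose R (x y : 'I_N.+1) := match unlift ord_max x, unlift ord_max y with
  | Some i, Some j => i %% r != j %% r
  | None, Some j => j \in A
  | _, _ => false
  end.
pose G := graph_of_rel R.
have adjL i j : adj G (lift ord_max i) (lift ord_max j) = (i %% r != j %% r).
  rewrite adj_rel /R !liftK (eq_sym (j %% r)) orbb (inj_eq lift_inj).
  by rewrite andb_idl //; apply: contraNneq => ->.
have adjv j : adj G ord_max (lift ord_max j) = (j \in A).
  by rewrite adj_rel /R unlift_none liftK orbF neq_lift.
exists G; split.
  have cr (i : 'I_N) : i %% r < r by rewrite ltn_mod.
  pose c (x : 'I_N.+1) := if unlift ord_max x is Some i then Ordinal (cr i) else Ordinal r0.
  apply: (@colored_clique_free _ _ _ c) => x y; rewrite /c.
  case: (unliftP ord_max x) => [i|] ->; case: (unliftP ord_max y) => [j|] ->.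
  - by rewrite adjL.
  - by rewrite adjC adjv => /(subsetP AF); rewrite inE.
  - by rewrite adjv => /(subsetP AF); rewrite inE eq_sym.
  - by rewrite adj_irrefl.
exists ord_max.
  rewrite subrK -AL -(card_imset _ (@lift_inj _ ord_max)); congr (Posz _).
  apply: eq_card => x; rewrite inE; case: (unliftP ord_max x) => [j|] ->.
    by rewrite adjv mem_imset //; apply: lift_inj.
  rewrite adj_irrefl; symmetry; apply/imsetP => -[j _ /eqP].
  by rewrite (negbTE (neq_lift _ _)).
pose U := {x : 'I_N.+1 | x \in [set~ ord_max]}.
have lP (i : 'I_N) : lift ord_max i \in [set~ ord_max].
  by rewrite !inE eq_sym neq_lift.
pose g i : U := Sub (lift ord_max i) (lP i).
have [h gK hK] : bijective g.
  apply: inj_card_bij => [i j /(congr1 val) /= /lift_inj //|].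
  rewrite card_sig card_ord (_ : #|_| = #|[set~ (ord_max : 'I_N.+1)]|).
    by rewrite cardsC1 card_ord.
  exact: eq_card.
exists h => [|x y]; first by exists g.
by rewrite -{2}(hK x) -{2}(hK y) adj_induced /= adjL adj_multipartite.
Qed.

(** * The bound, its equality case and tightness *)

Local Open Scope ring_scope.

Theorem theorem2p18
  (l : int) (l_ge : -1 <= l)
  (P : forall m : nat, sgraph 'I_m -> Prop)
  (P_stable : forall m : nat, stable (m%:Z + l) (P m))
  (nP : int)
  (P_complete : forall m : nat, nP <= m%:Z -> P m (complete_graph 'I_m))
  (r n : nat) (r_ge3 : (3 <= r)%N) (n_ge : nP <= n%:Z)
  (n_r3 : r = 3%N -> 6 * l + 26 <= n%:Z)
  (n_r47 : (4 <= r <= 7)%N ->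
     Num.max (3 + l%:~R + 4 * (l%:~R + 2) / (r%:R - 3))
             (5 + l%:~R + (r%:R + 2 * l%:~R + 7) / (2 * r%:R - 2))
       <= n%:R :> rat)
  (n_r8 : (8 <= r)%N ->
     l%:~R + 5 + 4 * (l%:~R + 4) / (r%:R - 4) <= n%:R :> rat)
  (n_r4 : r = 4%N -> 13 - l < n%:Z)
  (n_lN1 : l = -1 -> (5 <= r <= 7)%N -> (5 < n)%N)
  (n_r5 : 0 <= l -> r = 5%N -> Num.min (17 - l) (10 * l + 10) < n%:Z)
  (n_r67 : 0 <= l -> (6 <= r <= 7)%N ->
     Num.min (4 * r%:Z - 3 - l) (6 * l + 6) < n%:Z) :
  [/\ forall G : sgraph 'I_n, clique_free r.+1 G -> ~ P n G ->
        (num_edges G)%:Z <= (num_edges (turan r n.-1))%:Z + (l + 1),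
      exists G : sgraph 'I_n, turan_plus_vertex r l G,
      forall G : sgraph 'I_n, clique_free r.+1 G -> ~ P n G ->
        (num_edges G)%:Z = (num_edges (turan r n.-1))%:Z + (l + 1) ->
        turan_plus_vertex r l G
    & (exists G : sgraph 'I_n, turan_plus_vertex r l G /\ ~ P n G) ->
      exists G : sgraph 'I_n,
        [/\ clique_free r.+1 G, ~ P n G
          & (num_edges G)%:Z = (num_edges (turan r n.-1))%:Z + (l + 1)] ].
Proof.
have r0 : (0 < r)%N by lia.
(* L = l + 1, the degree of the additional vertex, is a natural number because l >= -1. *)
have [L lE] : exists L : nat, l = L%:Z - 1 by exists (absz (l + 1)); lia.
subst l; have lR : (L%:Z - 1)%:~R = L%:R - 1 :> rat by rewrite intrD.
rewrite lR in n_r47 n_r8.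
have {n_r3}h3 : r = 3%N -> (6 * L + 20 <= n)%N by move/n_r3; lia.
have {n_r8}h8 : (8 <= r -> (r - 4) * (L + 4) + 4 * (L + 3) <= (r - 4) * n)%N.
  move=> r8; have [p rp] : exists p, r = (p.+1 + 4)%N by exists (r - 5)%N; lia.
  have := n_r8 r8; rewrite {}rp natrD !addrK -lerBrDl ler_pdivrMr ?ltr0Sn // addnK.
  by rewrite -(ler_nat rat) !(natrD, natrM); nra.
have {n_r47 n_r4 n_lN1 n_r5 n_r67}h47 : (4 <= r <= 7)%N -> small_hyp r L n.
  move=> r47; have [p rp] : exists p, r = (p.+1 + 3)%N by exists (r - 4)%N; lia.
  have := n_r47 r47; rewrite ge_max => /andP[h1 h2]; apply/and5P; split.
  - move: h1; rewrite {1}rp natrD addrK -lerBrDl ler_pdivrMr ?ltr0Sn // rp addnK.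
    by rewrite -(ler_nat rat) !(natrD, natrM); nra.
  - have E : 2 * r%:R - 2 = (2 * r - 2)%:R :> rat by rewrite natrB ?natrM //; lia.
    move: h2; rewrite E -lerBrDl ler_pdivrMr ?ltr0n; last by lia.
    by rewrite -(ler_nat rat) !(natrD, natrM); nra.
  - by apply/implyP => /eqP/n_r4; lia.
  - by apply/implyP => /andP[/eqP L0 r5]; apply: n_lN1; lia.
  - apply/andP; split.
      by apply/implyP => /andP[L0 /eqP r5]; have := n_r5 _ r5; lia.
    by apply/implyP => /andP[L0 r6]; have := n_r67 _ _; lia.
have room : (L + n.-1 %/ r < n.-1)%N.
  (* If the additional vertex did not fit, then (r - 1)(n - 1) <= r L, which contradicts the lower
     bound on n in each range of r. *)
  have [p rp] : exists p, r = p.+3 by exists (r - 3)%N; lia.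
  rewrite ltnNge; apply/negP => rn; have h : (p.+2 * n.-1 <= p.+3 * L)%N.
    have := leq_divM n.-1 r; have := leq_mul (leqnn r) rn.
    by rewrite rp; move: (n.-1 %/ _)%N; lia.
  have [r3|[r47|r8]] : r = 3%N \/ (4 <= r <= 7)%N \/ (8 <= r)%N by lia.
  - have p0 : p = 0%N by lia.
    by have := h3 r3; subst p; lia.
  - have /and3P[_ + _] := h47 r47; rewrite rp.
    have -> : (2 * p.+3 - 2 = 2 * p.+2)%N by lia.
    by move: h; case: (n) => [|N] /=; lia.
  - have := h8 r8; rewrite rp; have [w wp] : exists w, p = w.+1 by exists (p - 1)%N; lia.
    rewrite wp in h *; rewrite (_ : w.+4 - 4 = w)%N; last by lia.
    by move: h; case: (n) => [|N] /=; lia.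
have tE := num_edges_turan n.-1 r0.
have key G : clique_free r.+1 G -> ~ P n G ->
    (num_edges G <= turan_size r n.-1 + L)%N /\
    (num_edges G = (turan_size r n.-1 + L)%N -> turan_plus_vertex r (L%:Z - 1) G).
  move=> clG nPG.
  have [S [S0 Sdeg Ssize]] := few_low_degrees (P_stable n) (P_complete n n_ge) nPG.
  have [/eqP/cards1P[v Sv]|S1] := eqVneq #|S| 1.
    have vdeg : (degree G v <= L)%N.
      by have := Sdeg v; rewrite Sv cards1 inE eqxx => /(_ isT).
    have [] := turan_theorem r0 (clique_free_induced (A := [set~ v]) clG).
    have -> : #|{: {x : 'I_n | x \in [set~ v]}}| = n.-1.
      by have := cardsC1 v; rewrite card_ord card_sig => <-; apply: eq_card.
    rewrite (num_edges_vertex G v) => le iso; split; first by lia.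
    move=> E; split=> //; exists v; [lia | apply: iso; lia].
  have {}Ssize : (2 * #|S| + L <= n)%N by lia.
  have SC : #|~: S| = (n - #|S|)%N by have := cardsC S; rewrite card_ord; lia.
  have {}Sdeg : {in S, forall x, degree G x <= #|S| + L - 1}%N.
    by move=> x /Sdeg; lia.
  have eA := edges_low_degrees r0 clG Sdeg; rewrite SC in eA.
  have [||D] := @edges_low_degrees_neighborhood _ G r.-1 (#|S| + L - 1) S _ _ S0 Sdeg.
  - by lia.
  - by rewrite prednK.
  rewrite SC => Dn eB.
  have S2 : (1 < #|S|)%N by lia.
  (* For at least two low-degree vertices the bound is strict, so the equality case is vacuous. *)
  have := low_degrees_strict r_ge3 S2 Ssize Dn h3 h47 h8 eA eB.
  rewrite subn1; lia.
split.
- by move=> G clG nPG; have [+ _] := key G clG nPG; rewrite tE; lia.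
- have n0 : (0 < n)%N by case: (n) room.
  rewrite -(prednK n0).
  exact: turan_plus_vertex_exists.
- by move=> G clG nPG E; have [_] := key G clG nPG; apply; rewrite tE in E; lia.
case=> G [Gplus nPG]; exists G; have [clG [v vdeg iso]] := Gplus; split=> //.
by rewrite (num_edges_vertex G v) (num_edges_iso iso); lia.
Qed.
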